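(* Suppose $B<R$ and travel is reimbursed by the new method, so that faculty member $i$'s out-of-pocket expense is $s_i-g_i(\mathbf r,s_i)$. To minimize out-of-pocket expenses, it is in the best interest of faculty member $i$ to spend less.
   Context: There are $n$ faculty members, each of whom submits a request for travel funds to attend a conference. Faculty member $j$ requests the amount $r_j>0$ (in dollars); $\mathbf r=(r_1,\dots,r_n)$, $R=r_1+\cdots+r_n$ is the total amount requested, and $B$ is the total amount budgeted for travel. The case of interest is $B<R$. The amount actually spent by faculty member $i$ is $s_i$, which she is able to determine before submitting her request; she has no control over the requests $r_j$, $j\ne i$, of the others. Under the new method, the amount reimbursed to faculty member $i$ is $$g_i(\mathbf r,s_i)=\begin{cases}(B/R)\,s_i & \text{if } s_i\le r_i,\\ (B/R)\,r_i & \text{if } s_i>r_i.\end{cases}$$ Faculty member $i$ is assumed to try to minimize her out-of-pocket expense $s_i-g_i(\mathbf r,s_i)$. That it is in her best interest to ''spend less'' means that decreasing how much she spends (for example by sharing a room or staying at a less expensive hotel while attending the same conference) decreases her out-of-pocket expense. *)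

(* Defs.v *)
From HB Require Import structures.
From mathcomp Require Import all_boot all_order all_algebra.
Set Implicit Arguments.
Unset Strict Implicit.
Unset Printing Implicit Defensive.
Import Order.TTheory GRing.Theory Num.Theory.
Local Open Scope ring_scope.

Definition total_requested (K : realFieldType) (n : nat) (r : 'I_n -> K) : K :=
  \sum_(j < n) r j.

Definition reimbursement (K : realFieldType) (n : nat) (B : K) (r : 'I_n -> K)
    (i : 'I_n) (s : K) : K :=
  if s <= r i then B / total_requested r * s
  else B / total_requested r * r i.

Definition out_of_pocket (K : realFieldType) (n : nat) (B : K) (r : 'I_n -> K)
    (i : 'I_n) (s : K) : K :=
  s - reimbursement B r i s.

(* The requests of all members, including r i, stay fixed while the amount spent
   by member i varies. *)
Definition best_to_spend_less (K : realFieldType) (n : nat) (B : K)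
    (r : 'I_n -> K) (i : 'I_n) : Prop :=
  forall s s' : K, s' < s -> out_of_pocket B r i s' < out_of_pocket B r i s.

(* Main.v *)
Require Import Defs.
From HB Require Import structures.
From mathcomp Require Import all_boot all_order all_algebra.
From mathcomp Require Import lra.
Import Order.TTheory GRing.Theory Num.Theory.
Local Open Scope ring_scope.

(** The ratio [B / R] is less than 1, so the out-of-pocket expense is continuous
    and piecewise linear in the amount spent, with slope [1 - B / R > 0] up to
    the request and slope 1 beyond it. *)

(** The index [i] makes the sum nonempty: its term is positive and the remaining ones are
    nonnegative. *)
Lemma total_requested_gt0 (K : realFieldType) (n : nat) (r : 'I_n -> K)
    (i : 'I_n) :
  (forall j, 0 < r j) -> 0 < total_requested r.
Proof.
move=> r_gt0; rewrite /total_requested (bigD1 i) //=.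
by rewrite ltr_wpDr // sumr_ge0 // => j _; exact: ltW.
Qed.

Theorem proposition2 (K : realFieldType) (n : nat) (r : 'I_n -> K) (B : K)
    (r_gt0 : forall j : 'I_n, 0 < r j)
    (B_lt_R : B < total_requested r)
    (i : 'I_n) :
  best_to_spend_less B r i.
Proof.
move=> s s' lt_s's; rewrite /out_of_pocket /reimbursement.
have ratio_lt1 : B / total_requested r < 1.
  by rewrite ltr_pdivrMr ?mul1r //; exact: (total_requested_gt0 _ _ _ i).
move: (B / total_requested r) ratio_lt1 => c c_lt1.
(* The expense drops by [(1 - c) * (s - s')] when both amounts are at most [r i], by [s - s'] when
   both exceed it, and by [(s - r i) + (1 - c) * (r i - s')] when [s' <= r i < s]. The case
   [s <= r i < s'] contradicts [s' < s]. *)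
by case: (leP s (r i)) => hs; case: (leP s' (r i)) => hs'; nra.
Qed.
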